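(* Let $t\ge2$ be odd, $r\ge1$, $N=t+2r$, $\zeta=e^{2\pi i/t}$, and let $\lambda=(\lambda_1\ge\dots\ge\lambda_N\ge0)$ be a partition with at most $N$ parts. Then $$s_\lambda\bigl(1,\zeta,\dots,\zeta^{t-1},z_1,z_1^{-1},\dots,z_r,z_r^{-1}\bigr)\equiv0\quad\text{(identically in }z_1,\dots,z_r)$$ if and only if some residue class modulo $t$ contains none of the numbers $\beta_j=\lambda_j+N-j$, $1\le j\le N$.
   Context: $s_\lambda$ is the Schur polynomial in $N$ variables and $z_1,\dots,z_r$ are independent indeterminates. *)

(* Defs.v *)
From HB Require Import structures.
From mathcomp Require Import all_boot all_fingroup all_algebra.
From mathcomp Require Import mpoly complex.
From mathcomp Require Import reals trigo.

Set Implicit Arguments.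
Unset Strict Implicit.
Unset Printing Implicit Defensive.

Import GRing.Theory.
Local Open Scope ring_scope.

(* Indices are 0-based: [beta lam j] is lambda_{j+1} + N - (j+1). *)
Definition beta (N : nat) (lam : N.-tuple nat) (j : 'I_N) : nat :=
  (tnth lam j + (N - j.+1))%N.

Definition alternant (N : nat) (b : 'I_N -> nat) : {mpoly int[N]} :=
  \det (\matrix_(i < N, j < N) ('X_i ^+ b j : {mpoly int[N]})).

Definition delta (N : nat) (j : 'I_N) : nat := (N - j.+1)%N.

(* Reducing T ^ (b j) modulo \prod_i (T - X_i) factors the matrix of the
   alternant through the Vandermonde matrix. *)
Lemma alternant_dvd (N : nat) (b : 'I_N -> nat) :
  exists s : {mpoly int[N]}, s * alternant (@delta N) == alternant b.
Proof.
pose A : comNzRingType := {mpoly int[N]}.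
pose x (i : 'I_N) : A := 'X_i.
pose P : {poly A} := \prod_(i < N) ('X - (x i)%:P).
have monP : P \is monic by apply: monic_prod_XsubC.
have sP : size P = N.+1.
  by rewrite /P size_prod_XsubC /index_enum -enumT size_enum_ord.
have rP i : P.[x i] = 0.
  by rewrite /P (bigD1 i) //= hornerM hornerXsubC subrr mul0r.
pose rem j := Pdiv.CommonRing.rmodp ('X^(b j) : {poly A}) P.
have srem j : (size (rem j) <= N)%N.
  by rewrite -ltnS -sP Pdiv.Ring.ltn_rmodpN0 // monic_neq0.
pose C := \matrix_(k < N, j < N) (rem j)`_(delta k).
exists (\det C); apply/eqP.
rewrite /alternant mulrC -det_mulmx; apply: (congr1 determinant).
apply/matrixP => i j; rewrite !mxE.
have := congr1 (fun q : {poly A} => q.[x i])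
               (Pdiv.RingMonic.rdivp_eq monP ('X^(b j))).
rewrite hornerXn hornerD hornerM rP mulr0 add0r => ->.
rewrite -/(rem j) (horner_coef_wide _ (srem j)) (reindex_inj rev_ord_inj) /=.
apply: eq_bigr => k _; rewrite !mxE mulrC.
by rewrite (_ : delta (rev_ord k) = k) // /delta /= subnSK // subKn // ltnW.
Qed.

Lemma alternant_delta_neq0 (N : nat) : alternant (@delta N) != 0.
Proof.
pose v : 'rV[{mpoly int[N]}]_N := \row_i 'X_(rev_ord i).
have -> : alternant (@delta N) = \det (Vandermonde N v).
  rewrite -[RHS]det_tr /alternant.
  rewrite -(_ : mxsub (@rev_ord N) (@rev_ord N)
      (\matrix_(i < N, j < N) ('X_i ^+ delta j)) = (Vandermonde N v)^T).
    pose s := perm (@rev_ord_inj N).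
    rewrite (_ : mxsub _ _ _ = row_perm s (col_perm s
      (\matrix_(i < N, j < N) ('X_i ^+ delta j)))); last first.
      by apply/matrixP => i j; rewrite !mxE !permE.
    rewrite row_permE col_permE !det_mulmx !det_perm.
    by rewrite mulrCA -signr_addb odd_permV addbb expr0 mulr1.
  by apply/matrixP => i j; rewrite !mxE /delta /= subnSK // subKn // ltnW.
rewrite det_Vandermonde; apply/prodf_neq0 => i _; apply/prodf_neq0 => j lt_ij.
rewrite !mxE subr_eq0; apply/eqP => /(congr1 (fun p => p@_U_(rev_ord j)%MM)).
rewrite !mcoeffX eqxx; case: eqP => // /(congr1 (fun m : 'X_{1..N} => m (rev_ord j))).
rewrite !mnm1E eqxx; case: eqP => // /rev_ord_inj e _ _.
by rewrite e ltnn in lt_ij.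
Qed.

(* The Schur polynomial in N variables, as the exact quotient
   a_(lambda + delta) / a_delta in Z[X_1, ..., X_N]; see [schurP]. *)
Definition schur (N : nat) (lam : N.-tuple nat) : {mpoly int[N]} :=
  xchoose (alternant_dvd (beta lam)).

Lemma schurP (N : nat) (lam : N.-tuple nat) (s : {mpoly int[N]}) :
  s * alternant (@delta N) = alternant (beta lam) <-> s = schur lam.
Proof.
have eqS := eqP (xchooseP (alternant_dvd (beta lam))).
split => [eqs|->]; last exact: eqS.
by apply: (mulIf (alternant_delta_neq0 N)); rewrite eqs eqS.
Qed.

Definition schur_eval (N : nat) (lam : N.-tuple nat) (F : comNzRingType)
    (v : 'I_N -> F) : F :=
  mmap (fun c : int => c%:~R) v (schur lam).

(* e^(2 pi i / t) *)
Definition zeta (R : realType) (t : nat) : R[i] :=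
  (cos (2 * pi / t%:R) +i* sin (2 * pi / t%:R))%C.

(* The field C(z_1, ..., z_r), with C = R[i] over an arbitrary model R of the
   real numbers. *)
Definition ratfun (R : realType) (r : nat) : fieldType :=
  {fraction {mpoly R[i][r]}}.

Definition cst (R : realType) (r : nat) (c : R[i]) : ratfun R r :=
  FracField.tofrac (c%:MP_[r] : {mpoly R[i][r]}).

Definition indet (R : realType) (r : nat) (k : 'I_r) : ratfun R r :=
  FracField.tofrac ('X_k : {mpoly R[i][r]}).

(* 1, zeta, ..., zeta^(t-1), z_1, z_1^-1, ..., z_r, z_r^-1 *)
Definition point (R : realType) (t r : nat) : seq (ratfun R r) :=
  [seq cst r (zeta R t) ^+ i | i <- iota 0 t] ++
  flatten [seq [:: indet R k; (indet R k)^-1] | k <- enum 'I_r].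

Lemma size_point (R : realType) (t r : nat) : size (point R t r) = (t + 2 * r)%N.
Proof.
rewrite size_cat size_map size_iota size_flatten /shape -map_comp.
congr (_ + _)%N; rewrite (eq_map (g := fun=> 2%N)) //.
by rewrite sumnE big_map big_const_seq count_predT iter_addn_0 size_enum_ord.
Qed.

(* Main.v *)
Require Import Defs.
From HB Require Import structures.
From mathcomp Require Import all_boot all_order all_fingroup all_algebra.
From mathcomp Require Import mpoly complex.
From mathcomp Require Import reals trigo.
From mathcomp Require Import zify.

(** Up to the nonzero Vandermonde factor, the value is det (x_i ^ beta_j). If a
class c is missed, the combination of the rows zeta^i with weights zeta^(-ic)
vanishes. If every class is hit, specialise z_k = 2^k w with w = X^4. Each class
has a unique element closest to theta, and the midpoints of consecutive elements
of the classes are pairwise distinct: two of them in classes c, c' can only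
coincide if 2c = 2c' mod t, and t is odd. There are 2r midpoints, so theta can be
put between the r-th and the (r+1)-st. Then, besides the closest elements, r of
the beta_j lie above theta and r below, and scaling column j by
w^(-|beta_j - theta|), with the matching powers of w on the rows, isolates in the
limit w -> oo the three blocks (class rows, closest), (z_k, above) and
(z_k^-1, below). The first is a permutation matrix up to a factor t and the other
two are Vandermonde matrices in the 2^(+-beta_j). *)

Set Implicit Arguments.
Unset Strict Implicit.
Unset Printing Implicit Defensive.

Import Order.TTheory GRing.Theory Num.Theory.

(** * Residue classes and the choice of a balanced threshold *)

Section ClassSplit.

Variables (t N : nat) (b : 'I_N -> nat).

(* The threshold is theta = (2n + 1) / 4, which is neither a [b j] nor the
   midpoint of two of them; [upper] and [lower] leave out the closest elements. *)
Definition upper (n : nat) : {set 'I_N} :=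
  [set j | [exists i : 'I_N,
     [&& b i == b j %[mod t], b i < b j & n < b i + b j]]].

Definition lower (n : nat) : {set 'I_N} :=
  [set j | [exists i : 'I_N,
     [&& b i == b j %[mod t], b j < b i & b i + b j <= n]]].

Definition middle (n : nat) : {set 'I_N} := ~: (upper n :|: lower n).

Lemma upperP n j :
  reflect (exists i, [/\ b i = b j %[mod t], b i < b j & n < b i + b j])
          (j \in upper n).
Proof.
rewrite inE; apply: (iffP existsP) => -[k].
  by case/and3P=> /eqP ? ? ?; exists k.
by case=> e ? ?; exists k; apply/and3P; split=> //; apply/eqP.
Qed.

Lemma lowerP n j :
  reflect (exists i, [/\ b i = b j %[mod t], b j < b i & b i + b j <= n])
          (j \in lower n).
Proof.
rewrite inE; apply: (iffP existsP) => -[k].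
  by case/and3P=> /eqP ? ? ?; exists k.
by case=> e ? ?; exists k; apply/and3P; split=> //; apply/eqP.
Qed.

Lemma upper_lower_disjoint n : [disjoint upper n & lower n].
Proof.
rewrite -setI_eq0; apply/eqP/setP=> j; rewrite in_setI [RHS]inE.
by apply/negP=> /andP[/upperP[i [_ ? ?]] /lowerP[k [_ ? ?]]]; lia.
Qed.

Lemma upper_gt n j : j \in upper n -> n < 2 * b j.
Proof. by case/upperP=> i [_ ? ?]; lia. Qed.

Lemma lower_le n j : j \in lower n -> 2 * b j <= n.
Proof. by case/lowerP=> i [_ ? ?]; lia. Qed.

(* 4 |j - theta|; one of the truncated differences is 0. *)
Definition cdist (n j : nat) : nat := (4 * j - n.*2.+1) + (n.*2.+1 - 4 * j).

(** Of two elements of a class, the lower is the closer to theta exactly when their midpoint exceeds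
    theta, that is, when their sum exceeds [n]. *)
Lemma middle_closest n j i :
  j \in middle n -> b i = b j %[mod t] -> b i <> b j ->
  cdist n (b j) < cdist n (b i).
Proof.
rewrite in_setC in_setU negb_or => /andP[/upperP up /lowerP lo] e ne.
have [lt|ge] := ltnP (b i) (b j).
  have ? : b i + b j <= n by rewrite leqNgt; apply/negP=> ?; apply: up; exists i.
  rewrite /cdist; lia.
have ? : n < b i + b j.
  by rewrite ltnNge; apply/negP=> ?; apply: lo; exists i; split=> //; lia.
rewrite /cdist; lia.
Qed.

Lemma middle_uniq n : injective b ->
  {in middle n &, forall i j, b i = b j %[mod t] -> i = j}.
Proof.
move=> inj_b i j mi mj e; apply: inj_b; apply/eqP/negPn/negP=> /eqP ne.
have := middle_closest mj e ne.
have := middle_closest mi (esym e) (not_eq_sym ne); lia.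
Qed.

Lemma middle_exists n j : exists2 i, i \in middle n & b i = b j %[mod t].
Proof.
have [i /eqP e min_i] := @arg_minnP _ j (fun i => b i == b j %[mod t])
  (fun i => cdist n (b i)) (eqxx _).
exists i => //; rewrite in_setC in_setU negb_or.
by apply/andP; split; apply/negP;
  [case/upperP|case/lowerP] => k [ek ? ?];
  have := min_i k; rewrite ek e eqxx /cdist => /(_ isT); lia.
Qed.

Hypothesis inj_b : injective b.
Hypothesis onto_b : forall c, exists j, b j = c %[mod t].
Hypothesis t_gt0 : 0 < t.

Lemma card_middle n : #|middle n| = t.
Proof.
pose f (j : 'I_N) : 'I_t := Ordinal (ltn_pmod (b j) t_gt0).
rewrite -[RHS](card_ord t) -cardsT.
rewrite -(_ : f @: middle n = [set: 'I_t]).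
  rewrite card_in_imset // => i j mi mj /(congr1 val) /=.
  exact: middle_uniq inj_b i j mi mj.
apply/setP=> c; rewrite inE; apply/imsetP.
have [j ej] := onto_b c; have [i mi ei] := middle_exists n j.
by exists i => //; apply: val_inj; rewrite /= ei ej modn_small.
Qed.

Lemma card_upperDlower n : #|upper n| + #|lower n| + t = N.
Proof.
rewrite -(card_middle n) -cardsUI.
have /eqP-> : upper n :&: lower n == set0.
  by rewrite setI_eq0 upper_lower_disjoint.
by rewrite cards0 addn0 cardsC card_ord.
Qed.

Hypothesis odd_t : odd t.

Lemma double_mod_inj i j : i + i = j + j %[mod t] -> i = j %[mod t].
Proof.
have cop : coprime t 2 by rewrite coprimen2.
wlog le_ij: i j / i <= j => [H|].
  by case/orP: (leq_total i j) => [/H//|/H K /esym/K].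
move/eqP; rewrite eq_sym eqn_mod_dvd; last by lia.
rewrite (_ : j + j - (i + i) = 2 * (j - i)); last by lia.
by rewrite Gauss_dvdr // -eqn_mod_dvd // => /eqP.
Qed.

(* An index leaving [upper] at step [n] has a lower neighbour in its class with
   the sum of the two equal to [n.+1]; as [t] is odd this sum determines the
   class, and then the index. *)
Lemma card_upperS n : #|upper n| <= #|upper n.+1|.+1.
Proof.
have sub : upper n.+1 \subset upper n.
  by apply/subsetP=> j /upperP[i [? ? ?]]; apply/upperP; exists i; split=> //; lia.
rewrite -(cardsID (upper n.+1) (upper n)) (setIidPr sub) -[leqRHS]addn1 leq_add2l.
have drop j : j \in upper n :\: upper n.+1 ->
    exists i, [/\ b i = b j %[mod t], b i < b j & b i + b j = n.+1].
  rewrite inE => /andP[/upperP nup /upperP[i [e lt ?]]]; exists i; split=> //.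
  by apply/eqP; rewrite eqn_leq andbC; apply/andP; split=> //;
    rewrite leqNgt; apply/negP=> ?; apply: nup; exists i.
apply/card_le1_eqP=> j k.
wlog le_jk: j k / b k <= b j => [H|].
  case/orP: (leq_total (b k) (b j)) => [le|le]; first exact: H.
  by move=> hj hk; apply/esym/H.
move=> hj hk; apply: inj_b; apply/eqP; rewrite eqn_leq le_jk leqNgt.
apply/negP=> lt_kj; have [i [ei lti si]] := drop _ hj.
have [l [el ltl sl]] := drop _ hk.
have ejk : b j = b k %[mod t].
  apply: double_mod_inj.
  by rewrite -[LHS]modnDml -ei modnDml si -sl -[LHS]modnDml el modnDml.
(* The lower neighbour [l] of [k] would keep [j] in [upper n.+1]: [b l + b j] exceeds [b l + b k],
   which is [n.+1]. *)
move: hj; rewrite inE => /andP[/upperP[]]; exists l; split; last by lia.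
  by rewrite el ejk.
by lia.
Qed.

(** A discrete intermediate value argument: the size of [upper n] is 2r at [n = 0], is eventually 0,
    and drops by at most one per step. *)
Lemma balanced_split r : N = t + 2 * r ->
  exists n, #|upper n| = r /\ #|lower n| = r.
Proof.
move=> eN.
suff [n en]: exists n, #|upper n| = r.
  by exists n; split=> //; have := card_upperDlower n; lia.
have lo0 : #|lower 0| = 0.
  apply/eqP; rewrite cards_eq0; apply/eqP/setP=> j; rewrite [RHS]inE.
  by apply/negP=> /lowerP[i [_ ? ?]]; lia.
have ex : exists n, #|upper n| <= r.
  exists (\sum_j 2 * b j); rewrite (_ : upper _ = set0) ?cards0 //.
  apply/setP=> j; rewrite [RHS]inE; apply/negP=> /upper_gt.
  by rewrite (bigD1 j) //=; lia.
have [[|n] le_n min_n] := ex_minnP ex.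
  by exists 0; have := card_upperDlower 0; lia.
exists n.+1; apply/eqP; rewrite eqn_leq le_n /= -ltnS.
apply: leq_trans (card_upperS n); rewrite ltnNge; apply/negP=> /min_n.
by rewrite ltnn.
Qed.

End ClassSplit.

(** * Leading coefficients of a polynomial kernel vector *)

Local Open Scope ring_scope.

(** Invertibility of a Vandermonde matrix: the polynomial vanishing at every node except [x i]
    isolates [a i]. *)
Lemma power_sums_eq0 (F : fieldType) (I : finType) (A : {set I}) (x a : I -> F) :
  {in A &, injective x} ->
  (forall k, (k < #|A|)%N -> \sum_(j in A) a j * x j ^+ k = 0) ->
  {in A, forall j, a j = 0}.
Proof.
move=> inj_x sum0 i iA.
pose p := \prod_(c <- [seq x j | j <- enum (A :\ i)]) ('X - c%:P).
have szp : size p = #|A| by rewrite size_prod_XsubC size_map -cardE [RHS](cardsD1 i) iA.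
have p0 j : j \in A -> j != i -> p.[x j] = 0.
  move=> jA ne; apply/rootP; rewrite root_prod_XsubC map_f //.
  by rewrite mem_enum !inE ne.
have pi : p.[x i] != 0.
  rewrite -[_ == 0]/(root p (x i)) root_prod_XsubC.
  apply/mapP=> -[j]; rewrite mem_enum !inE => /andP[ne jA] /inj_x e.
  by rewrite e ?eqxx in ne.
have: \sum_(j in A) a j * p.[x j] = 0.
  under eq_bigr do rewrite horner_coef szp mulr_sumr.
  rewrite exchange_big big1 // => k _ /=.
  under eq_bigr do rewrite mulrCA.
  by rewrite -mulr_sumr sum0 ?mulr0.
rewrite (bigD1 i) //= big1 => [|j /andP[jA ne]]; last by rewrite p0 ?mulr0.
by move/eqP; rewrite addr0 mulf_eq0 (negbTE pi) orbF => /eqP.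
Qed.

(** [v] is a kernel vector of the specialised matrix, with the root-of-unity rows combined into
    class sums and the rows of z_k^-1 multiplied by z_k^K. Since theta is a quarter-integer, ['X^4]
    makes the scaling exponents integral. *)
Lemma sparse_kernel_eq0 (F : numFieldType) (t r K : nat)
    (b : 'I_(t + 2 * r) -> nat) (v : 'I_(t + 2 * r) -> {poly F}) :
  odd t -> injective b -> (forall c, exists j, b j = c %[mod t]) ->
  (forall j, b j <= K)%N ->
  (forall i, \sum_(j | b j == b i %[mod t]) v j = 0) ->
  (forall k, (k < r)%N -> \sum_j v j * (2 ^+ k *: 'X^4) ^+ b j = 0) ->
  (forall k, (k < r)%N -> \sum_j v j * (2 ^+ k *: 'X^4) ^+ (K - b j) = 0) ->
  forall j, v j = 0.
Proof.
move=> odd_t inj_b onto_b leK class0 up0 lo0 j0.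
apply/eqP/negPn/negP=> v0.
have t_gt0 : (0 < t)%N by case: (t) odd_t.
have [n [card_up card_lo]] := balanced_split inj_b onto_b t_gt0 odd_t erefl.
pose w j := v j * 'X^(cdist n (b j)).
have [i _ max_i] := @arg_maxnP _ j0 xpredT (fun j => size (w j)) isT.
have wi0 : w i != 0.
  rewrite -size_poly_gt0; apply: leq_trans (max_i j0 isT).
  by rewrite size_poly_gt0 mulf_neq0 // -size_poly_gt0 size_polyXn.
(* Only the coefficients of top degree [D] of the scaled [v j] matter. *)
pose D := (size (w i)).-1.
have sizew j : (size (w j) <= D.+1)%N.
  by rewrite prednK ?size_poly_gt0 //; exact: max_i.
pose a j := (w j)`_D.
have ai : a i != 0 by rewrite -[a i]/(lead_coef (w i)) lead_coef_eq0.
have top m e j : e = (m + cdist n (b j))%N -> (v j * 'X^e)`_(D + m) = a j.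
  by move=> ->; rewrite exprD mulrCA coefXnM addnK ltnNge leq_addl.
have low m e j : (e < m + cdist n (b j))%N -> (v j * 'X^e)`_(D + m) = 0.
  move=> lt; have [->|nz] := eqVneq (v j) 0; first by rewrite mul0r coef0.
  have := sizew j; rewrite /w size_mulXn // => sz.
  by apply: nth_default; rewrite size_mulXn //; lia.
have scaled k e j : v j * (2 ^+ k *: 'X^4) ^+ e =
    (2 ^+ e) ^+ k *: (v j * 'X^(4 * e)).
  by rewrite exprZn -!exprM -scalerAr [(k * e)%N]mulnC.
(* The other members of the class are farther from theta than [j], so they miss the top degree. *)
have mid j : j \in middle t b n -> a j = 0.
  move=> mj; have := class0 j.
  move/(congr1 (fun p : {poly F} => (p * 'X^(cdist n (b j)))`_(D + 0))).
  rewrite mul0r coef0 mulr_suml coef_sum (bigD1 j) //= top // big1 ?addr0 //.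
  move=> k /andP[/eqP e ne]; apply: low; apply: middle_closest mj e _.
  by move/inj_b=> e'; rewrite e' eqxx in ne.
have pow2_inj : injective (fun e => 2 ^+ e : F).
  by move=> e f /(ieexprIn (ltr0Sn _ _)) -> //; rewrite (eqr_nat _ 2 1).
have up j : j \in upper t b n -> a j = 0.
  apply: (power_sums_eq0 (x := fun j => 2 ^+ b j)) => [k l _ _ /pow2_inj/inj_b//|k].
  (* [4 * b l] equals [n.*2.+1 + cdist n (b l)] if [b l] is above theta and is smaller otherwise.
     The middle terms above theta vanish by [mid], so only [upper] remains. *)
  rewrite card_up => /up0/(congr1 (fun p : {poly F} => p`_(D + n.*2.+1))).
  rewrite coef0 coef_sum => {2}<-; rewrite big_mkcond; apply: eq_bigr => l _.
  rewrite scaled coefZ mulrC; case: ifP => [/upper_gt ?|nup].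
    by rewrite top // /cdist; lia.
  have [ml|] := boolP (l \in middle t b n).
    have [gt|le] := ltnP n (2 * b l); last by rewrite low ?mulr0 // /cdist; lia.
    by rewrite top ?mid ?mulr0 // /cdist; lia.
  rewrite in_setC in_setU nup negbK => /lower_le ?.
  by rewrite low ?mulr0 // /cdist; lia.
have lo j : j \in lower t b n -> a j = 0.
  apply: (power_sums_eq0 (x := fun j => 2 ^+ (K - b j))) => [k l _ _ /pow2_inj e|k].
    by apply: inj_b; have := leK k; have := leK l; lia.
  (* The mirror image: [4 * (K - b l) + n.*2.+1] reaches [4 * K + cdist n (b l)] only below
     theta. *)
  rewrite card_lo => /lo0/(congr1 (fun p : {poly F} => (p * 'X^(n.*2.+1))`_(D + 4 * K))).
  rewrite mul0r coef0 mulr_suml coef_sum => {2}<-.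
  rewrite big_mkcond; apply: eq_bigr => l _; have ? := leK l.
  rewrite scaled -scalerAl -mulrA -exprD coefZ mulrC; case: ifP => [/lower_le ?|nlo].
    by rewrite top // /cdist; lia.
  have [ml|] := boolP (l \in middle t b n).
    have [gt|le] := ltnP n (2 * b l); first by rewrite low ?mulr0 // /cdist; lia.
    by rewrite top ?mid ?mulr0 // /cdist; lia.
  rewrite in_setC in_setU nlo orbF negbK => /upper_gt ?.
  by rewrite low ?mulr0 // /cdist; lia.
case/negP: ai; apply/eqP; have [/mid//|] := boolP (i \in middle t b n).
by rewrite in_setC in_setU negbK => /orP[/up|/lo].
Qed.

(** * Roots of unity and class filters *)

Lemma zetaX (R : realType) (t n : nat) :
  zeta R t ^+ n =
  (cos (2 * pi / t%:R * n%:R) +i* sin (2 * pi / t%:R * n%:R))%C.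
Proof.
rewrite /zeta; set a := 2 * pi / t%:R.
elim: n => [|n IHn]; first by rewrite mulr0 cos0 sin0.
rewrite exprSr IHn -(addn1 n) natrD mulrDr mulr1 cosD sinD.
by rewrite [sin _ * _ + _]addrC.
Qed.

Lemma zeta_prim (R : realType) (t : nat) :
  (0 < t)%N -> t.-primitive_root (zeta R t).
Proof.
move=> t_gt0; apply/andP; split=> //; apply/forallP=> i; apply/eqP.
have tR : t%:R != 0 :> R by rewrite pnatr_eq0 -lt0n.
have e2pi : 2 * pi = pi *+ 2 :> R by rewrite mulr_natl.
rewrite unity_rootE zetaX; have [->|ne] := eqVneq i.+1 t.
  by rewrite divfK // e2pi cos2pi sin2pi eqxx.
(* By cos 2y = 1 - 2 sin^2 y, a power equal to 1 would force sin y = 0, but 0 < y < pi. *)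
set y : R := pi / t%:R * i.+1%:R.
have -> : 2 * pi / t%:R * i.+1%:R = y *+ 2 by rewrite -[RHS]mulr_natl /y !mulrA.
apply/negP=> /eqP[+ _]; rewrite cos_mulr2n cos2sin2.
have : 0 < sin y.
  have ltit : (i.+1 < t)%N by rewrite ltn_neqAle ne ltn_ord.
  apply: sin_gt0_pi; rewrite /y; apply/andP; split.
    by rewrite mulr_gt0 ?divr_gt0 ?pi_gt0 ?ltr0n.
  by rewrite mulrAC ltr_pdivrMr ?ltr0n // ltr_pM2l ?pi_gt0 // ltr_nat.
move=> /gt_eqF siny /eqP.
rewrite mulrnBl -addrA [- _ + _]addrC addrA (_ : 1 *+ 2 - 1 = 1); last first.
  by rewrite mulr2n addrK.
by rewrite -subr_eq0 addrAC subrr sub0r oppr_eq0 mulrn_eq0 expf_eq0 /= siny.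
Qed.

Lemma sum_prim_root (F : idomainType) (t : nat) (z : F) (n : nat) :
  t.-primitive_root z ->
  \sum_(i < t) z ^+ (i * n) = if (t %| n)%N then t%:R else 0.
Proof.
move=> pz; under eq_bigr do rewrite mulnC exprM.
case: ifP => [dvd|ndvd].
  rewrite (eqP (_ : z ^+ n == 1)) -?(prim_order_dvd pz) //.
  by under eq_bigr do rewrite expr1n; rewrite sumr_const card_ord.
have : (z ^+ n - 1) * (\sum_(i < t) z ^+ n ^+ i) == 0.
  by rewrite -subrX1 exprAC (prim_expr_order pz) expr1n subrr.
by rewrite mulf_eq0 subr_eq0 -(prim_order_dvd pz) ndvd => /eqP.
Qed.

(** [t - c %% t] represents -c modulo [t] as a natural exponent. *)
Lemma dvdn_addB_mod (t m c : nat) :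
  (0 < t)%N -> (t %| m + (t - c %% t))%N = (m == c %[mod t]).
Proof.
move=> t_gt0; have lt := ltn_pmod c t_gt0.
by rewrite -[in RHS](modn_mod c) -(eqn_modDr (t - c %% t)) subnKC ?(ltnW lt) // modnn.
Qed.

(** * From Schur values to alternants *)

Lemma schur_eval_alternant (N : nat) (lam : N.-tuple nat) (F : comNzRingType)
    (x : 'I_N -> F) :
  schur_eval lam x * \det (\matrix_(i, j) x i ^+ delta j) =
  \det (\matrix_(i, j) x i ^+ beta lam j).
Proof.
pose f : {rmorphism {mpoly int[N]} -> F} := mmap (intr : {rmorphism int -> F}) x.
have mapX (e : 'I_N -> nat) : \det (\matrix_(i, j) x i ^+ e j) = f (alternant e).
  rewrite -det_map_mx; congr (\det _); apply/matrixP=> i j.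
  by rewrite !mxE rmorphXn /= mmapX mmap1U.
by rewrite !mapX -[schur_eval _ _]/(f _) -rmorphM ((schurP lam _).2 erefl).
Qed.

Lemma beta_inj (N : nat) (lam : N.-tuple nat) :
  sorted geq lam -> injective (beta lam).
Proof.
move=> dec.
have lt (i j : 'I_N) : (i < j)%N -> (beta lam j < beta lam i)%N.
  move=> ltij; have: (tnth lam j <= tnth lam i)%N.
    rewrite !(tnth_nth 0%N).
    have geq_trans : transitive geq by move=> a b c /= ? ?; lia.
    apply: (sorted_leq_nth geq_trans leqnn 0%N dec); rewrite ?inE ?size_tuple //.
    exact: ltnW.
  by rewrite /beta; have := ltn_ord i; have := ltn_ord j; lia.
by move=> i j e; apply: val_inj => /=; case: (ltngtP i j) => // /lt; lia.
Qed.

Lemma delta_inj (N : nat) : injective (@delta N).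
Proof.
by move=> i j; rewrite /delta => e; apply: val_inj => /=;
  have := ltn_ord i; have := ltn_ord j; lia.
Qed.

(** * The alternants at the given point *)

Section Point.

Variables (R : realType) (t r : nat).
Let C : numFieldType := R[i].
Let N := (t + 2 * r)%N.

Definition label : eqType := (nat + 'I_r * bool)%type.

Definition labels : seq label :=
  map inl (iota 0 t) ++
  map inr [seq (k, c) | k <- enum 'I_r, c <- [:: false; true]].

Definition label_value (d : label) : ratfun R r :=
  match d with
  | inl i => cst r (zeta R t) ^+ i
  | inr (k, c) => if c then (indet R k)^-1 else indet R k
  end.

Lemma point_labels : point R t r = map label_value labels.
Proof.
rewrite /point map_cat -!map_comp; congr (_ ++ _).
by rewrite map_flatten -map_comp.
Qed.

Lemma size_labels : size labels = N.
Proof. by rewrite -(size_map label_value) -point_labels size_point. Qed.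

(* Powers of a coordinate of the point, with the denominator cleared; the
   exponents [e] are at most [K]. *)
Definition label_power (K : nat) (d : label) (e : nat) : {mpoly C[r]} :=
  match d with
  | inl i => (zeta R t ^+ (i * e))%:MP
  | inr (k, c) => 'X_k ^+ (if c then K - e else e)%N
  end.

(** The factor is z_k^K for z_k^-1 and 1 otherwise; being independent of [e], it comes out of the
    determinant as a row factor. *)
Lemma label_powerE K d : exists s : ratfun R r, forall e, (e <= K)%N ->
  FracField.tofrac (label_power K d e) = s * label_value d ^+ e.
Proof.
case: d => [i|[k c]].
  by exists 1 => e _ /=; rewrite mul1r -exprM rmorphXn tofracXn.
case: c; last by exists 1 => e _ /=; rewrite mul1r tofracXn.
have X0 : indet R k != 0.
  rewrite tofrac_eq0; apply/eqP=> /(congr1 (fun p => p@_U_(k)%MM)).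
  by rewrite mcoeffX eqxx mcoeff0 => /eqP; rewrite oner_eq0.
exists (indet R k ^+ K) => e le /=.
by rewrite tofracXn exprVn -expfB_cond ?(negbTE X0).
Qed.

Lemma det_point_neq0 (b : 'I_N -> nat) :
  odd t -> injective b -> (forall c, exists j, b j = c %[mod t]) ->
  \det (\matrix_(i, j) nth 0 (point R t r) i ^+ b j) != 0.
Proof.
move=> odd_t inj_b onto_b; apply/eqP=> det0.
have t_gt0 : (0 < t)%N by case: (t) odd_t.
pose K := \max_j b j.
have leK j : (b j <= K)%N by exact: leq_bigmax.
pose d (i : 'I_N) := nth (inl 0%N : label) labels i.
pose B : 'M[{mpoly C[r]}]_N := \matrix_(i, j) label_power K (d i) (b j).
have detB : \det B = 0.
  apply/eqP; rewrite -tofrac_eq0 -det_map_mx.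
  have [s sE] := fin_all_exists (fun i => label_powerE K (d i)).
  rewrite (_ : map_mx _ _ = diag_mx (\row_i s i) *m
                \matrix_(i, j) nth 0 (point R t r) i ^+ b j).
    by rewrite det_mulmx det0 mulr0.
  apply/matrixP=> i j; rewrite mul_diag_mx /B !mxE /= sE // point_labels.
  by rewrite (nth_map (inl 0%N : label)) ?size_labels.
pose phi : {rmorphism {mpoly C[r]} -> {poly C}} :=
  mmap (polyC : {rmorphism C -> {poly C}}) (fun k => 2 ^+ k *: 'X^4).
(* The transpose turns the left kernel of [det0P] into a linear relation between columns, tested on
   each label by [rel]. *)
have /eqP/det0P[v v0 vB] : \det (map_mx phi B)^T = 0.
  by rewrite det_tr det_map_mx detB rmorph0.
have rel (l : label) : l \in labels ->
    \sum_j v 0 j * phi (label_power K l (b j)) = 0.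
  move=> ll; have lt : (index l labels < N)%N by rewrite -size_labels index_mem.
  have := congr1 (fun w : 'rV_N => w 0 (Ordinal lt)) vB; rewrite !mxE => {2}<-.
  by apply: eq_bigr => j _; rewrite !mxE /d /= nth_index.
have phiX k : phi 'X_k = 2 ^+ k *: 'X^4 by rewrite /phi /= mmapX mmap1U.
have pz := zeta_prim R t_gt0.
have inr_labels k c : inr (k, c) \in labels.
  rewrite mem_cat; apply/orP; right; apply: map_f.
  by apply: allpairs_f; rewrite ?mem_enum //; case: c.
case/eqP: v0; apply/rowP=> j; rewrite mxE.
apply: (sparse_kernel_eq0 odd_t inj_b onto_b leK) => [i|k lt|k lt].
(* Weighting the root-of-unity rows by zeta^(-l b_i) and summing filters out the class of [b i], up
   to the factor [t]. *)
- pose m := (t - b i %% t)%N.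
  have tC : t%:R%:P != 0 :> {poly C} by rewrite polyC_eq0 (prim_root_natf_neq0 pz).
  apply: (mulIf tC); rewrite mul0r mulr_suml.
  transitivity (\sum_(l < t) (zeta R t ^+ (l * m))%:P *
      \sum_j v 0 j * phi (label_power K (inl (l : nat)) (b j))).
    under [RHS]eq_bigr do rewrite mulr_sumr.
    rewrite exchange_big big_mkcond; apply: eq_bigr => h _ /=.
    under [RHS]eq_bigr do rewrite mmapC mulrCA -polyCM -exprD -mulnDr.
    rewrite -mulr_sumr -rmorph_sum (sum_prim_root _ pz) addnC dvdn_addB_mod //.
    by case: ifP; rewrite ?mulr0.
  apply: big1 => l _; rewrite rel ?mulr0 // mem_cat map_f //.
  by rewrite mem_iota add0n ltn_ord.
- rewrite -[RHS](rel _ (inr_labels (Ordinal lt) false)).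
  by apply: eq_bigr => h _; rewrite rmorphXn phiX.
- rewrite -[RHS](rel _ (inr_labels (Ordinal lt) true)).
  by apply: eq_bigr => h _; rewrite rmorphXn phiX.
Qed.

Lemma det_point_eq0 (b : 'I_N -> nat) (c : nat) :
  (0 < t)%N -> (forall j, b j <> c %[mod t]) ->
  \det (\matrix_(i, j) nth 0 (point R t r) i ^+ b j) = 0.
Proof.
move=> t_gt0 no_c; apply/eqP/det0P; pose z := cst r (zeta R t).
have pz : t.-primitive_root z.
  pose f : {rmorphism R[i] -> ratfun R r} :=
    @FracField.tofrac {mpoly R[i][r]} \o @mpolyC r R[i].
  by rewrite -[z]/(f _) fmorph_primitive_root zeta_prim.
pose m := (t - c %% t)%N.
exists (row_mx (\row_(i < t) z ^+ (i * m)) 0).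
  apply/eqP=> /(congr1 (fun w : 'rV__ => w 0 (lshift _ (Ordinal t_gt0)))).
  by rewrite row_mxEl !mxE => /eqP; rewrite oner_eq0.
apply/rowP=> j; rewrite !mxE big_split_ord /=.
rewrite [X in _ + X]big1 => [|i _]; last by rewrite row_mxEr !mxE mul0r.
rewrite addr0 -[RHS](_ : \sum_(i < t) z ^+ (i * (b j + m)) = 0).
  apply: eq_bigr => i _; rewrite row_mxEl !mxE /= nth_cat size_map size_iota.
  rewrite ltn_ord (nth_map 0%N) ?size_iota // nth_iota // add0n -exprM -exprD.
  by rewrite -mulnDr addnC.
by rewrite (sum_prim_root _ pz) dvdn_addB_mod //; case: eqP => // /no_c.
Qed.

End Point.

Theorem corollary8p22 (R : realType) (t r : nat)
    (lam : (t + 2 * r).-tuple nat) :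
  (2 <= t)%N -> odd t -> (1 <= r)%N -> sorted geq lam ->
  (schur_eval lam (fun i : 'I_(t + 2 * r) => nth 0%R (point R t r) i) = 0%R
   <-> exists c : 'I_t, forall j : 'I_(t + 2 * r),
         beta lam j <> c %[mod t]).
Proof.
move=> t_ge2 odd_t _ dec; have t_gt0 := ltnW t_ge2.
have delta_onto c : exists j : 'I_(t + 2 * r), delta j = c %[mod t].
  have lt : (c %% t < t + 2 * r)%N by rewrite ltn_addr ?ltn_pmod.
  exists (rev_ord (Ordinal lt)).
  by rewrite /delta /= subnSK // subKn ?modn_mod // ltnW.
have eqS := schur_eval_alternant lam (fun i => nth 0 (point R t r) i).
(* The denominator is the same determinant for the exponents 0, ..., N-1, which meet every class as
   N >= t. *)
have delta0 := det_point_neq0 R odd_t (@delta_inj _) delta_onto.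
split=> [S0|[c no_c]]; last first.
  by apply: (mulIf delta0); rewrite mul0r eqS (det_point_eq0 R t_gt0 no_c).
have [/existsP[c /forallP no_c]|onto] :=
    boolP [exists c : 'I_t, [forall j, beta lam j != c %[mod t]]].
  by exists c => j; apply/eqP.
have beta_onto c : exists j, beta lam j = c %[mod t].
  have := existsPn onto (Ordinal (ltn_pmod c t_gt0)).
  rewrite negb_forall => /existsP[j /negPn/eqP e].
  by exists j; rewrite e modn_mod.
have := det_point_neq0 R odd_t (beta_inj dec) beta_onto.
by rewrite -eqS S0 mul0r eqxx.
Qed.
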